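(* Let $(V,\mu,\nu)$ be an $IF$-normed space, let $p=(p_j)_{j\ge 0}$ and $q=(q_k)_{k\ge 0}$ belong to $SVA_+$, let $(x_{mn})_{m,n\ge 0}$ be a double sequence in $V$, let $x\in V$, and assume that $(x_{mn})$ is $(\bar N,p,q;1,1)$ summable to $x$. Then $x_{mn}\to x$ in $(V,\mu,\nu)$ if and only if for all $t>0$ $$\sup_{0<\lambda<1}\liminf_{m,n\to\infty}\mu\left(\frac{1}{(P_m-P_{\lambda_m})(Q_n-Q_{\lambda_n})}\sum_{j=\lambda_m+1}^{m}\sum_{k=\lambda_n+1}^{n}p_jq_k(x_{mn}-x_{jk}),t\right)=1$$ and $$\inf_{0<\lambda<1}\limsup_{m,n\to\infty}\nu\left(\frac{1}{(P_m-P_{\lambda_m})(Q_n-Q_{\lambda_n})}\sum_{j=\lambda_m+1}^{m}\sum_{k=\lambda_n+1}^{n}p_jq_k(x_{mn}-x_{jk}),t\right)=0.$$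
   Context: An $IF$-normed space $(V,\mu,\nu)$ is a real vector space $V$ with zero vector $\theta$ together with functions (fuzzy sets) $\mu,\nu:V\times\mathbb{R}\to[0,1]$ such that for all $x,y\in V$ and $t,s\in\mathbb{R}$: (a) $\mu(x,t)=0$ for $t\le 0$; (b) $\mu(x,t)=1$ for all $t>0$ if and only if $x=\theta$; (c) $\mu(cx,t)=\mu(x,t/|c|)$ for all $t>0$ and real $c\neq 0$; (d) $\mu(x+y,t+s)\ge\min\{\mu(x,t),\mu(y,s)\}$; (e) $\lim_{t\to\infty}\mu(x,t)=1$, and $\lim_{t\to 0}\mu(x,t)=0$ if $x\ne\theta$; (f) $\nu(x,t)=1$ for $t\le 0$; (g) $\nu(x,t)=0$ for all $t>0$ if and only if $x=\theta$; (h) $\nu(cx,t)=\nu(x,t/|c|)$ for all $t>0$ and real $c\ne 0$; (i) $\nu(x+y,t+s)\le\max\{\nu(x,t),\nu(y,s)\}$; (j) $\lim_{t\to\infty}\nu(x,t)=0$, and $\lim_{t\to 0}\nu(x,t)=1$ if $x\ne\theta$. A double sequence $(x_{mn})$ in $V$ converges to $x\in V$, written $x_{mn}\to x$, if for each $t>0$ and $\varepsilon\in(0,1)$ there is $n_0\in\mathbb{N}$ with $\mu(x_{mn}-x,t)>1-\varepsilon$ and $\nu(x_{mn}-x,t)<\varepsilon$ for all $m,n\ge n_0$. Limits of real double sequences are in Pringsheim's sense: $\liminf_{m,n\to\infty}a_{mn}=\lim_{N\to\infty}\inf_{m,n\ge N}a_{mn}$, and similarly for $\limsup$ (terms need only be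 defined for large $m,n$). Weights $p=(p_j)_{j\ge0}$, $q=(q_k)_{k\ge0}$ are sequences of nonnegative reals with $p_0,q_0>0$, $P_m=\sum_{j=0}^m p_j\to\infty$ and $Q_n=\sum_{k=0}^n q_k\to\infty$. Put $t^{11}_{mn}=\frac{1}{P_mQ_n}\sum_{j=0}^m\sum_{k=0}^n p_jq_kx_{jk}$. The double sequence $(x_{mn})$ is $(\bar N,p,q;1,1)$ summable to $x$ if $t^{11}_{mn}\to x$. For $\lambda>0$, $\lambda_m=[\lambda m]$ is the integer part of $\lambda m$ (likewise $\lambda_n=[\lambda n]$). $SVA_+$ is the set of nonnegative sequences $p=(p_j)$ with $p_0>0$ such that $\liminf_{m\to\infty}\left|\frac{P_{\lambda_m}}{P_m}-1\right|>0$ for all $\lambda>0$ with $\lambda\ne1$. *)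

(* Defs.v *)
From HB Require Import structures.
From mathcomp Require Import all_boot all_order all_algebra.
From mathcomp Require Import all_classical all_reals all_analysis.

Set Implicit Arguments.
Unset Strict Implicit.
Unset Printing Implicit Defensive.

Import Order.TTheory GRing.Theory Num.Theory.
Import numFieldNormedType.Exports.

Local Open Scope classical_set_scope.
Local Open Scope ring_scope.

Record IF_normed (R : realType) (V : lmodType R) (mu nu : V -> R -> R) : Prop :=
  { IF_mu01 : forall x t, 0 <= mu x t <= 1 ;
    IF_nu01 : forall x t, 0 <= nu x t <= 1 ;
    IF_mu_nonpos : forall x t, t <= 0 -> mu x t = 0 ;
    IF_mu_zero : forall x, (forall t, 0 < t -> mu x t = 1) <-> x = 0 ;
    IF_mu_scale : forall x t c, 0 < t -> c != 0 -> mu (c *: x) t = mu x (t / `|c|) ;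
    IF_mu_add : forall x y t s, Num.min (mu x t) (mu y s) <= mu (x + y) (t + s) ;
    IF_mu_pinfty : forall x, mu x t @[t --> +oo] --> (1 : R) ;
    IF_mu_at0 : forall x, x != 0 -> mu x t @[t --> (0 : R)^'] --> (0 : R) ;
    IF_nu_nonpos : forall x t, t <= 0 -> nu x t = 1 ;
    IF_nu_zero : forall x, (forall t, 0 < t -> nu x t = 0) <-> x = 0 ;
    IF_nu_scale : forall x t c, 0 < t -> c != 0 -> nu (c *: x) t = nu x (t / `|c|) ;
    IF_nu_add : forall x y t s, nu (x + y) (t + s) <= Num.max (nu x t) (nu y s) ;
    IF_nu_pinfty : forall x, nu x t @[t --> +oo] --> (0 : R) ;
    IF_nu_at0 : forall x, x != 0 -> nu x t @[t --> (0 : R)^'] --> (1 : R) }.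

Definition IF_cvg2 (R : realType) (V : lmodType R) (mu nu : V -> R -> R)
    (x : nat -> nat -> V) (l : V) : Prop :=
  forall t eps : R, 0 < t -> 0 < eps < 1 ->
  exists n0 : nat, forall m n : nat, (n0 <= m)%N -> (n0 <= n)%N ->
    1 - eps < mu (x m n - l) t /\ nu (x m n - l) t < eps.

(* Pringsheim lower and upper limits. They are taken in the extended reals, where
   the monotone sequence of tail infima (suprema) always has a limit; the values
   at finitely many rows and columns are irrelevant. *)
Definition dliminf (R : realType) (a : nat -> nat -> R) : \bar R :=
  limn (fun N : nat =>
    ereal_inf [set (a i.1 i.2)%:E | i in [set i | (N <= i.1)%N /\ (N <= i.2)%N]]).

Definition dlimsup (R : realType) (a : nat -> nat -> R) : \bar R :=
  limn (fun N : nat =>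
    ereal_sup [set (a i.1 i.2)%:E | i in [set i | (N <= i.1)%N /\ (N <= i.2)%N]]).

Definition psum (R : realType) (p : nat -> R) (m : nat) : R :=
  \sum_(0 <= j < m.+1) p j.

Definition weight (R : realType) (p : nat -> R) : Prop :=
  [/\ forall j, 0 <= p j, 0 < p 0%N & psum p m @[m --> \oo] --> +oo].

Definition t11 (R : realType) (V : lmodType R) (p q : nat -> R)
    (x : nat -> nat -> V) (m n : nat) : V :=
  (psum p m * psum q n)^-1 *:
    \sum_(0 <= j < m.+1) \sum_(0 <= k < n.+1) (p j * q k) *: x j k.

Definition Nbar11_summable (R : realType) (V : lmodType R) (mu nu : V -> R -> R)
    (p q : nat -> R) (x : nat -> nat -> V) (l : V) : Prop :=
  IF_cvg2 mu nu (t11 p q x) l.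

Definition ipart (R : realType) (lam : R) (m : nat) : nat :=
  Num.truncn (lam * m%:R).

Definition SVA_plus (R : realType) (p : nat -> R) : Prop :=
  [/\ forall j, 0 <= p j, 0 < p 0%N &
      forall lam : R, 0 < lam -> lam != 1 ->
        (0 < limn_einf (fun m => `|psum p (ipart lam m) / psum p m - 1|%:E))%E].

(* The denominator may vanish for small m, n; for p and q in [SVA_plus] and
   0 < lam < 1 it is positive for all large m, n, so the totalization of the
   inverse is invisible to [dliminf] and [dlimsup]. *)
Definition window_dev (R : realType) (V : lmodType R) (p q : nat -> R)
    (x : nat -> nat -> V) (lam : R) (m n : nat) : V :=
  ((psum p m - psum p (ipart lam m)) * (psum q n - psum q (ipart lam n)))^-1 *:
    \sum_((ipart lam m).+1 <= j < m.+1) \sum_((ipart lam n).+1 <= k < n.+1)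
      (p j * q k) *: (x m n - x j k).

(* Main.v *)
Require Import Defs.
From HB Require Import structures.
From mathcomp Require Import all_boot all_order all_algebra.
From mathcomp Require Import all_classical all_reals all_analysis.
From mathcomp Require Import lra.
Import Order.TTheory GRing.Theory Num.Theory.
Import numFieldNormedType.Exports.
Local Open Scope classical_set_scope.
Local Open Scope ring_scope.

(** The identity behind the theorem is [window_dev_split]: over the window
    ]lam_m, m] x ]lam_n, n], the weighted sum of the [x j k] is obtained from
    four partial double sums by inclusion-exclusion, and each partial double sum
    is a weight times a weighted mean [t11]. Hence [(x m n - l)] minus the window
    deviation is a combination of [t11 - l] at the four corners of the window,
    the coefficients being ratios such as [P_m Q_n / (Delta P Delta Q)]. The
    condition [SVA_plus] bounds these ratios ([SVA_window_mass]), the corners all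
    go to infinity ([ipart_ge]), so summability makes the combination tend to
    zero ([window_dev_sub_vanish]). In other words, for every fixed [lam] in
    ]0, 1[, [x m n - l] and the window deviation differ by something negligible.

    Consequently convergence of [x] makes the window deviation small for every
    [lam], while conversely it is enough that for each tolerance some [lam] makes
    it small; this is [tauberian_vanish]. The supremum of lower limits (infimum
    of upper limits) of the statement says exactly the latter
    ([sup_dliminf_eqP], [inf_dlimsup_eq0P]).

    The functions [mu] and [1 - nu] obey the same four rules, collected in
    [fuzzy_norm]; everything is proved once for such a function and applied to
    both. Working with them separately is legitimate since the two halves of the
    condition may use different values of [lam]. *)

(** * Double sequences and Pringsheim limits *)

Definition eventually2 (P : nat -> nat -> Prop) : Prop :=
  exists N, forall m n, (N <= m)%N -> (N <= n)%N -> P m n.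

Lemma eventually2_and (P Q : nat -> nat -> Prop) :
  eventually2 P -> eventually2 Q -> eventually2 (fun m n => P m n /\ Q m n).
Proof.
move=> [N HN] [M HM]; exists (maxn N M) => m n.
by rewrite !geq_max => /andP[? ?] /andP[? ?]; split; [exact: HN|exact: HM].
Qed.

Lemma eventually2_mono (P Q : nat -> nat -> Prop) :
  (forall m n, P m n -> Q m n) -> eventually2 P -> eventually2 Q.
Proof. by move=> PQ [N HN]; exists N => m n ? ?; apply/PQ/HN. Qed.

Lemma eventually2_prod (P Q : nat -> Prop) :
  (exists N, forall m, (N <= m)%N -> P m) ->
  (exists N, forall n, (N <= n)%N -> Q n) ->
  eventually2 (fun m n => P m /\ Q n).
Proof.
move=> [N HN] [M HM]; exists (maxn N M) => m n.
by rewrite !geq_max => /andP[? ?] /andP[? ?]; split; [exact: HN|exact: HM].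
Qed.

Section PringsheimLimits.
Context {R : realType}.
Implicit Types (a : nat -> nat -> R) (c : R).

Let tail_inf a (N : nat) : \bar R :=
  ereal_inf [set (a i.1 i.2)%:E | i in [set i | (N <= i.1)%N /\ (N <= i.2)%N]].

Lemma tail_inf_nondecreasing a : {homo tail_inf a : N M / (N <= M)%N >-> (N <= M)%E}.
Proof.
move=> N M NM; apply: le_ereal_inf_tmp => _ [i /= [? ?] <-].
by apply: ereal_inf_lbound; exists i => //=; split; apply: leq_trans NM _.
Qed.

Lemma dliminfE a : dliminf a = ereal_sup (range (tail_inf a)).
Proof.
by apply/cvg_lim => //; apply: ereal_nondecreasing_cvgn; exact: tail_inf_nondecreasing.
Qed.

Lemma lt_dliminf a c : (c%:E < dliminf a)%E -> eventually2 (fun m n => c < a m n).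
Proof.
rewrite dliminfE => /ereal_sup_gt[_ [N _ <-]] cN.
exists N => m n Nm Nn; rewrite -lte_fin; apply: (lt_le_trans cN).
by apply: ereal_inf_lbound; exists (m, n).
Qed.

Lemma dliminf_ge a c : eventually2 (fun m n => c <= a m n) -> (c%:E <= dliminf a)%E.
Proof.
move=> [N HN]; rewrite dliminfE.
apply: (@le_trans _ _ (tail_inf a N)).
  by apply: le_ereal_inf_tmp => _ [[m n] /= [? ?] <-]; rewrite lee_fin; exact: HN.
by apply: ereal_sup_ubound; exists N.
Qed.

Lemma dliminf_le a c : (forall m n, a m n <= c) -> (dliminf a <= c%:E)%E.
Proof.
move=> ac; rewrite dliminfE; apply: ge_ereal_sup => _ [N _ <-].
apply: (@le_trans _ _ (a N N)%:E); last by rewrite lee_fin.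
by apply: ereal_inf_lbound; exists (N, N) => //=.
Qed.

Lemma dlimsupN a : dlimsup a = (- dliminf (fun m n => (- a m n)%R))%E.
Proof.
rewrite /dlimsup /dliminf -limeN; last first.
  apply: ereal_nondecreasing_is_cvgn.
  exact: (tail_inf_nondecreasing (fun m n => - a m n)).
congr (limn _); apply/funext => N.
rewrite /ereal_inf oppeK; congr ereal_sup.
rewrite image_comp; congr image; apply/funext => i /=.
by rewrite opprK.
Qed.

Context {I : Type} (D : set I).

(** Since the values are capped by [c], the equality with [c] only says that the
    lower limits come arbitrarily close to [c]; a lower limit above [c - eps] in
    turn is a statement about all large indices. *)
Lemma sup_dliminf_eqP (a : I -> nat -> nat -> R) c :
  (forall i m n, a i m n <= c) ->
  ereal_sup [set dliminf (a i) | i in D] = c%:E <->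
  forall eps, 0 < eps ->
    exists2 i, D i & eventually2 (fun m n => c - eps < a i m n).
Proof.
move=> ac; split=> [supc eps e0|H].
  have : ((c - eps)%:E < ereal_sup [set dliminf (a i) | i in D])%E.
    by rewrite supc lte_fin ltrBlDr ltrDl.
  by move=> /ereal_sup_gt[_ [i Di <-]] /lt_dliminf; exists i.
apply/eqP; rewrite eq_le; apply/andP; split.
  by apply: ge_ereal_sup => _ [i Di <-]; exact: dliminf_le.
apply/lee_subgt0Pr => e e0; have [i Di Hi] := H _ e0.
apply: (@le_trans _ _ (dliminf (a i))); last first.
  by apply: ereal_sup_ubound; exists i.
by rewrite -EFinB; apply: dliminf_ge; apply: eventually2_mono Hi => m n /ltW.
Qed.

Lemma inf_dlimsup_eq0P (a : I -> nat -> nat -> R) :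
  (forall i m n, 0 <= a i m n) ->
  ereal_inf [set dlimsup (a i) | i in D] = 0%E <->
  forall eps, 0 < eps ->
    exists2 i, D i & eventually2 (fun m n => a i m n < eps).
Proof.
move=> a0.
have -> : ereal_inf [set dlimsup (a i) | i in D] =
    (- ereal_sup [set dliminf (fun m n => (- a i m n)%R) | i in D])%E.
  rewrite /ereal_inf image_comp; congr (- ereal_sup _)%E.
  by congr image; apply/funext => i /=; rewrite dlimsupN oppeK.
have an i m n : - a i m n <= 0 by rewrite oppr_le0.
have supP := sup_dliminf_eqP (fun i m n => - a i m n) 0 an.
split=> [H eps e0|H].
  have /supP /(_ _ e0)[i Di Hi] :
      ereal_sup [set dliminf (fun m n => - a i m n) | i in D] = 0%E.
    by rewrite -[LHS]oppeK H oppe0.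
  by exists i => //; apply: eventually2_mono Hi => m n; rewrite sub0r ltrN2.
have /supP -> : forall eps, 0 < eps ->
    exists2 i, D i & eventually2 (fun m n => 0 - eps < - a i m n).
  move=> eps e0; have [i Di Hi] := H _ e0; exists i => //.
  by apply: eventually2_mono Hi => m n; rewrite sub0r ltrN2.
by rewrite oppe0.
Qed.

End PringsheimLimits.

(** * Fuzzy norms *)

(** The part of [IF_normed] that is symmetric in [mu] and [1 - nu]. *)
Record fuzzy_norm {R : realType} {V : lmodType R} (f : V -> R -> R) : Prop :=
  { fuzzy_le1 : forall x t, f x t <= 1 ;
    fuzzy_zero : forall t, 0 < t -> f 0 t = 1 ;
    fuzzy_scale : forall x t c, 0 < t -> c != 0 -> f (c *: x) t = f x (t / `|c|) ;
    fuzzy_add : forall x y t s, Num.min (f x t) (f y s) <= f (x + y) (t + s) }.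

Arguments fuzzy_le1 {R V f}.
Arguments fuzzy_zero {R V f}.
Arguments fuzzy_scale {R V f}.
Arguments fuzzy_add {R V f}.

Lemma IF_normed_mu {R : realType} {V : lmodType R} (mu nu : V -> R -> R) :
  IF_normed mu nu -> fuzzy_norm mu.
Proof.
move=> h; split.
- by move=> x t; have /andP[] := IF_mu01 h x t.
- by apply/(IF_mu_zero h).
- exact: IF_mu_scale h.
- exact: IF_mu_add h.
Qed.

Lemma IF_normed_nu {R : realType} {V : lmodType R} (mu nu : V -> R -> R) :
  IF_normed mu nu -> fuzzy_norm (fun x t => 1 - nu x t).
Proof.
move=> h; split.
- by move=> x t; have /andP[? _] := IF_nu01 h x t; rewrite lerBlDr lerDl.
- by move=> t t0; rewrite ((IF_nu_zero h 0).2 erefl t t0) subr0.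
- by move=> x t c t0 c0; rewrite (IF_nu_scale h).
- move=> x y t s; have := IF_nu_add h x y t s.
  rewrite le_max ge_min => /orP[] H; apply/orP; [left|right];
  by rewrite lerD2l lerN2.
Qed.

Definition vanish {R : realType} {V : lmodType R} (f : V -> R -> R)
    (y : nat -> nat -> V) : Prop :=
  forall t eps, 0 < t -> 0 < eps -> eventually2 (fun m n => 1 - eps < f (y m n) t).

Lemma IF_cvg2P {R : realType} {V : lmodType R} (mu nu : V -> R -> R)
    (x : nat -> nat -> V) (l : V) :
  IF_cvg2 mu nu x l <->
  vanish mu (fun m n => x m n - l) /\
  vanish (fun y t => 1 - nu y t) (fun m n => x m n - l).
Proof.
split=> [H|[Hmu Hnu] t eps t0 /andP[e0 _]]; last first.
  apply: eventually2_mono (eventually2_and _ _ (Hmu _ _ t0 e0) (Hnu _ _ t0 e0)).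
  by move=> m n [? ?]; split=> //; lra.
(* Convergence is only tested for eps < 1; a larger eps is replaced by 1/2. *)
have small eps : 0 < eps -> 0 < Num.min eps (2^-1 : R) < 1.
  move=> e0; rewrite lt_min e0 invr_gt0 ltr0n /= gt_min invf_lt1 ?ltr0n//.
  by rewrite ltr1n orbT.
have mine eps : Num.min eps (2^-1 : R) <= eps by rewrite ge_min lexx.
split=> t eps t0 e0; have [N HN] := H _ _ t0 (small _ e0); exists N => m n Nm Nn;
  by have := mine eps; have [] := HN _ _ Nm Nn; lra.
Qed.

Section FuzzyNorm.
Context {R : realType} {V : lmodType R} {f : V -> R -> R} (hf : fuzzy_norm f).

(** Splitting [x] as [x + 0] and spending the surplus [s - t] on the zero vector. *)
Lemma fuzzy_mono x t s : t <= s -> f x t <= f x s.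
Proof.
rewrite le_eqVlt => /orP[/eqP -> //|ts].
have := fuzzy_add hf x 0 t (s - t).
by rewrite (fuzzy_zero hf) ?subr_gt0// addr0 addrC subrK min_l// (fuzzy_le1 hf).
Qed.

Lemma fuzzy_scale_ge x t c C : 0 < t -> 0 < C -> `|c| <= C -> f x (t / C) <= f (c *: x) t.
Proof.
move=> t0 C0 cC; have [->|c0] := eqVneq c 0.
  by rewrite scale0r (fuzzy_zero hf) // (fuzzy_le1 hf).
rewrite (fuzzy_scale hf)//; apply: fuzzy_mono.
by rewrite ler_pM2l// lef_pV2 ?posrE ?normr_gt0.
Qed.

Lemma vanishD y z : vanish f y -> vanish f z -> vanish f (fun m n => y m n + z m n).
Proof.
move=> Hy Hz t eps t0 e0; have t20 : 0 < t / 2 by rewrite divr_gt0.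
apply: eventually2_mono (eventually2_and _ _ (Hy _ _ t20 e0) (Hz _ _ t20 e0)).
move=> m n [ym zm]; rewrite [t]splitr.
by apply: lt_le_trans (fuzzy_add hf _ _ _ _); rewrite lt_min ym.
Qed.

(** The bound [C] is absorbed by the parameter: [f (c *: y) t >= f y (t / C)]. *)
Lemma vanishZ (c : nat -> nat -> R) C y :
  0 < C -> eventually2 (fun m n => `|c m n| <= C) ->
  vanish f y -> vanish f (fun m n => c m n *: y m n).
Proof.
move=> C0 Hc Hy t eps t0 e0.
apply: eventually2_mono (eventually2_and _ _ Hc (Hy _ _ (divr_gt0 t0 C0) e0)).
by move=> m n [cC ym]; apply: lt_le_trans (fuzzy_scale_ge _ _ _ _ t0 C0 cC).
Qed.

Lemma vanishN y : vanish f y -> vanish f (fun m n => - y m n).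
Proof.
have c1 : eventually2 (fun _ _ => `|-1 : R| <= 1).
  by exists 0%N => m n _ _; rewrite normrN normr1.
move=> Hy t eps t0 e0; have := vanishZ _ _ _ ltr01 c1 Hy t eps t0 e0.
by apply: eventually2_mono => m n; rewrite scaleN1r.
Qed.

Lemma vanish_comp (phi psi : nat -> nat) y :
  (forall N, exists M, forall m, (M <= m)%N -> (N <= phi m)%N) ->
  (forall N, exists M, forall m, (M <= m)%N -> (N <= psi m)%N) ->
  vanish f y -> vanish f (fun m n => y (phi m) (psi n)).
Proof.
move=> Hphi Hpsi Hy t eps t0 e0; have [N HN] := Hy _ _ t0 e0.
apply: eventually2_mono (eventually2_prod _ _ (Hphi N) (Hpsi N)).
by move=> m n [? ?]; exact: HN.
Qed.

End FuzzyNorm.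

(** * Weights and windows *)

Section Windows.
Context {R : realType}.

Lemma ipart_le (lam : R) m : 0 < lam < 1 -> (ipart lam m <= m)%N.
Proof.
move=> /andP[l0 l1]; rewrite truncn_le_nat.
apply: (@le_lt_trans _ _ m%:R); last by rewrite ltr_nat.
by rewrite ler_piMl// ltW.
Qed.

Lemma ipart_ge (lam : R) : 0 < lam ->
  forall N, exists M, forall m, (M <= m)%N -> (N <= ipart lam m)%N.
Proof.
move=> l0 N; exists (Num.truncn (N%:R / lam)).+1 => m Mm.
rewrite truncn_ge_nat ?mulr_ge0// ?(ltW l0)// mulrC -ler_pdivrMr//.
by apply: ltW; apply: lt_le_trans (truncnS_gt _) _; rewrite ler_nat.
Qed.

Lemma psum_gt0 (p : nat -> R) m : weight p -> 0 < psum p m.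
Proof.
move=> [p0 p00 _]; rewrite /psum big_ltn//.
by apply: ltr_pwDl => //; apply: sumr_ge0.
Qed.

Lemma psum_le (p : nat -> R) i m : weight p -> (i <= m)%N -> psum p i <= psum p m.
Proof.
move=> [p0 _ _] im; rewrite /psum (@big_cat_nat _ _ _ i.+1 0 m.+1)//= lerDl.
by apply: sumr_ge0.
Qed.

(** For [lam < 1] the absolute value in [SVA_plus] is [1 - P_lam_m / P_m], so the
    window carries a fixed proportion of the total mass. *)
Lemma SVA_window_mass (p : nat -> R) (lam : R) : weight p -> SVA_plus p -> 0 < lam < 1 ->
  exists2 d, 0 < d & exists N, forall m, (N <= m)%N ->
    d * psum p m <= psum p m - psum p (ipart lam m).
Proof.
move=> wp [_ _ /(_ lam)] + /[dup] lam01 /andP[l0 l1].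
move=> /(_ l0); rewrite (lt_eqF l1) => /(_ isT).
rewrite limn_einf_lim.
have /cvg_lim -> // := ereal_nondecreasing_cvgn (nondecreasing_einfs
  (fun m => `|psum p (ipart lam m) / psum p m - 1|%:E)).
move=> /ereal_sup_gt[_ [N _ <-]] infN.
set A := einfs _ _ in infN.
have Ale m : (N <= m)%N -> (A <= `|psum p (ipart lam m) / psum p m - 1|%:E)%E.
  by move=> Nm; apply: ereal_inf_lbound; exists m.
have Afin : A \is a fin_num.
  rewrite fin_numE gt_eqF ?(lt_trans _ infN) ?ltNy0//=.
  by rewrite lt_eqF// (le_lt_trans (Ale N _)) ?ltry.
move: infN Ale; rewrite -(fineK Afin); move: (fine A) => d.
rewrite lte_fin => d0 Ale; exists d => //; exists N => m Nm.
have Pm := psum_gt0 p m wp; have := Ale m Nm; rewrite lee_fin.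
have Pi := psum_le p _ _ wp (ipart_le lam m lam01).
rewrite ler0_norm; last by rewrite subr_le0 ler_pdivrMr// mul1r.
rewrite opprB => /(ler_wpM2r (ltW Pm)).
by rewrite mulrBl mul1r divfK// gt_eqF.
Qed.

End Windows.

Section WindowIdentity.
Context {R : realType} {V : lmodType R} (p q : nat -> R).
Implicit Types (x : nat -> nat -> V).

Lemma sum_window (U : zmodType) (F : nat -> U) i m : (i <= m)%N ->
  \sum_(i.+1 <= k < m.+1) F k =
  \sum_(0 <= k < m.+1) F k - \sum_(0 <= k < i.+1) F k.
Proof.
by move=> im; rewrite (@big_cat_nat _ _ _ i.+1 0 m.+1)//= [RHS]addrC addKr.
Qed.

Let S x m n := \sum_(0 <= j < m.+1) \sum_(0 <= k < n.+1) (p j * q k) *: x j k.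

Lemma sum_window2 x i m j n : (i <= m)%N -> (j <= n)%N ->
  \sum_(i.+1 <= a < m.+1) \sum_(j.+1 <= b < n.+1) (p a * q b) *: x a b =
  (S x m n - S x m j) - (S x i n - S x i j).
Proof.
move=> im jn; rewrite sum_window//.
by congr (_ - _); rewrite -sumrB; apply: eq_bigr => a _; rewrite sum_window.
Qed.

Lemma sum_window_const (v : V) i m j n : (i <= m)%N -> (j <= n)%N ->
  \sum_(i.+1 <= a < m.+1) \sum_(j.+1 <= b < n.+1) (p a * q b) *: v =
  ((psum p m - psum p i) * (psum q n - psum q j)) *: v.
Proof.
move=> im jn; rewrite -(sum_window R p _ _ im) -(sum_window R q _ _ jn).
rewrite big_distrlr scaler_suml; apply: eq_bigr => a _.
by rewrite scaler_suml.
Qed.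

Lemma partial_sum_t11 x l m n : psum p m != 0 -> psum q n != 0 ->
  S x m n = (psum p m * psum q n) *: ((t11 p q x m n - l) + l).
Proof. by move=> ? ?; rewrite subrK scalerA mulfV ?scale1r// mulf_neq0. Qed.

(** The coefficients [c] add up to 1 with the signs of the inclusion-exclusion,
    which is why the limit [l] can be subtracted from every mean at once. *)
Lemma window_dev_split x l lam m n :
  weight p -> weight q -> 0 < lam < 1 ->
  psum p (ipart lam m) < psum p m -> psum q (ipart lam n) < psum q n ->
  let i := ipart lam m in let j := ipart lam n in
  let d a b := t11 p q x a b - l in
  let c a b := psum p a * psum q b /
    ((psum p m - psum p i) * (psum q n - psum q j)) in
  (x m n - l) - window_dev p q x lam m n =
  (c m n *: d m n - c m j *: d m j) - (c i n *: d i n - c i j *: d i j).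
Proof.
move=> wp wq lam01 Pim Qjn i j d c.
have im : (i <= m)%N := ipart_le lam m lam01.
have jn : (j <= n)%N := ipart_le lam n lam01.
have P0 k : psum p k != 0 by rewrite gt_eqF// psum_gt0.
have Q0 k : psum q k != 0 by rewrite gt_eqF// psum_gt0.
have D0 : (psum p m - psum p i) * (psum q n - psum q j) != 0.
  by rewrite mulf_neq0// gt_eqF// subr_gt0.
have -> : window_dev p q x lam m n = x m n -
    ((psum p m - psum p i) * (psum q n - psum q j))^-1 *:
      ((S x m n - S x m j) - (S x i n - S x i j)).
  rewrite /window_dev -/i -/j.
  under eq_bigr do (under eq_bigr do rewrite scalerBr; rewrite sumrB).
  rewrite sumrB sum_window_const// sum_window2// scalerBr scalerA.
  by rewrite mulVf// scale1r.
have cE a b : ((psum p m - psum p i) * (psum q n - psum q j))^-1 *: S x a b =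
    c a b *: d a b + c a b *: l.
  by rewrite (partial_sum_t11 x l)// scalerA scalerDr mulrC.
have c1 : (c m n - c m j) - (c i n - c i j) = 1.
  by rewrite /c -!mulrBl -!mulrBr -mulrBl divff.
have addB (a b a' b' : V) : (a + b) - (a' + b') = (a - a') + (b - b').
  by rewrite opprD addrACA.
clearbody c d; rewrite opprB addrC subrKA !scalerBr !cE.
rewrite (addB (c m n *: d m n)) (addB (c i n *: d i n)) addB.
by rewrite -[l in _ - l]scale1r -c1 !scalerBl addrK.
Qed.

End WindowIdentity.

(** * The Tauberian equivalence *)

Section Tauberian.
Context {R : realType} {V : lmodType R} {f : V -> R -> R} (hf : fuzzy_norm f).
Context {p q : nat -> R} {x : nat -> nat -> V} {l : V}.
Hypotheses (wp : weight p) (wq : weight q) (sp : SVA_plus p) (sq : SVA_plus q).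
Hypothesis t11_cvg : vanish f (fun m n => t11 p q x m n - l).

(** The four terms of [window_dev_split] vanish separately, their coefficients
    being at most [(d * e)^-1] when the windows carry at least the proportions
    [d] and [e] of the masses. *)
Lemma window_dev_sub_vanish lam : 0 < lam < 1 ->
  vanish f (fun m n => (x m n - l) - window_dev p q x lam m n).
Proof.
move=> lam01; have lam0 : 0 < lam by case/andP: lam01.
have [d d0 Hd] := SVA_window_mass p lam wp sp lam01.
have [e e0 He] := SVA_window_mass q lam wq sq lam01.
have mass := eventually2_prod _ _ Hd He.
pose i m := ipart lam m.
pose D m n := (psum p m - psum p (i m)) * (psum q n - psum q (i n)).
(* Every corner (a, b) of the window has P_a Q_b <= P_m Q_n. *)
have corner (phi psi : nat -> nat) :
    (forall m, (phi m <= m)%N) -> (forall m, (psi m <= m)%N) ->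
    (forall N, exists M, forall m, (M <= m)%N -> (N <= phi m)%N) ->
    (forall N, exists M, forall m, (M <= m)%N -> (N <= psi m)%N) ->
    vanish f (fun m n => (psum p (phi m) * psum q (psi n) / D m n) *:
      (t11 p q x (phi m) (psi n) - l)).
  move=> phile psile phioo psioo.
  apply: (@vanishZ _ _ _ hf _ ((d * e)^-1)); first by rewrite invr_gt0 mulr_gt0.
    apply: eventually2_mono mass => m n [Pd Qe].
    have Pm := psum_gt0 p m wp; have Qn := psum_gt0 q n wq.
    have dP : 0 < d * psum p m by rewrite mulr_gt0.
    have eQ : 0 < e * psum q n by rewrite mulr_gt0.
    have D0 : 0 < D m n.
      by apply: mulr_gt0; [apply: lt_le_trans Pd|apply: lt_le_trans Qe].
    rewrite ger0_norm; last first.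
      by apply: divr_ge0; rewrite (ltW D0, mulr_ge0)// ltW// psum_gt0.
    rewrite ler_pdivrMr// ler_pdivlMl ?mulr_gt0//.
    apply: (@le_trans _ _ ((d * psum p m) * (e * psum q n))).
      rewrite [leRHS]mulrACA ler_pM2l ?mulr_gt0//.
      by apply: ler_pM; rewrite ?psum_le// ltW// psum_gt0.
    by apply: ler_pM; rewrite ?(ltW dP) ?(ltW eQ).
  exact: (vanish_comp phi psi (fun m n => t11 p q x m n - l)).
have ile m : (i m <= m)%N := ipart_le lam m lam01.
have ioo := ipart_ge lam lam0.
have idoo : forall N, exists M, forall m, (M <= m)%N -> (N <= m)%N.
  by move=> N; exists N.
have comb := vanishD hf _ _
  (vanishD hf _ _ (corner id id leqnn leqnn idoo idoo)
    (vanishN hf _ (corner id i leqnn ile idoo ioo)))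
  (vanishN hf _ (vanishD hf _ _ (corner i id ile leqnn ioo idoo)
    (vanishN hf _ (corner i i ile ile ioo ioo)))).
move=> t eps t0 eps0.
apply: eventually2_mono (eventually2_and _ _ mass (comb _ _ t0 eps0)).
move=> m n [[Pd Qe]]; rewrite (window_dev_split _ _ _ l)//.
  by rewrite -subr_gt0; apply: lt_le_trans Pd; rewrite mulr_gt0 ?psum_gt0.
by rewrite -subr_gt0; apply: lt_le_trans Qe; rewrite mulr_gt0 ?psum_gt0.
Qed.

(** Either of [x m n - l] and the window deviation is the other plus a vanishing
    term. In the converse direction [lam] may depend on [eps], because the
    vanishing term is small for every [lam]. *)
Lemma tauberian_vanish :
  vanish f (fun m n => x m n - l) <->
  forall t, 0 < t -> forall eps, 0 < eps ->
    exists2 lam, 0 < lam < 1 &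
      eventually2 (fun m n => 1 - eps < f (window_dev p q x lam m n) t).
Proof.
split=> [xl t t0 eps e0|H t eps t0 e0].
  (* Any lam in ]0, 1[ would do. *)
  have h01 : 0 < (2^-1 : R) < 1 by lra.
  exists 2^-1 => //.
  have := vanishD hf _ _ xl (vanishN hf _ (window_dev_sub_vanish _ h01)).
  move=> /(_ t eps t0 e0); apply: eventually2_mono => m n.
  by rewrite subKr.
have t20 : 0 < t / 2 by rewrite divr_gt0.
have [lam lam01 Hlam] := H _ t20 _ e0.
apply: eventually2_mono
  (eventually2_and _ _ Hlam (window_dev_sub_vanish _ lam01 _ _ t20 e0)).
move=> m n [wg dg]; rewrite [t]splitr.
rewrite -[x m n - l](subrK (window_dev p q x lam m n)).
by apply: lt_le_trans (fuzzy_add hf _ _ _ _); rewrite lt_min dg.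
Qed.

End Tauberian.

Theorem theorem10 (R : realType) (V : lmodType R) (mu nu : V -> R -> R)
    (p q : nat -> R) (x : nat -> nat -> V) (l : V)
    (hIF : IF_normed mu nu)
    (hwp : weight p) (hwq : weight q)
    (hp : SVA_plus p) (hq : SVA_plus q)
    (hx : Nbar11_summable mu nu p q x l) :
  IF_cvg2 mu nu x l <->
  (forall t : R, 0 < t ->
     ereal_sup [set dliminf (fun m n => mu (window_dev p q x lam m n) t)
               | lam in [set lam : R | 0 < lam < 1]] = 1%E
     /\
     ereal_inf [set dlimsup (fun m n => nu (window_dev p q x lam m n) t)
               | lam in [set lam : R | 0 < lam < 1]] = 0%E).
Proof.
have [tmu tnu] := (IF_cvg2P mu nu _ _).1 hx.
have muP := tauberian_vanish (IF_normed_mu _ _ hIF) hwp hwq hp hq tmu.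
have nuP := tauberian_vanish (IF_normed_nu _ _ hIF) hwp hwq hp hq tnu.
have supP t := @sup_dliminf_eqP R R [set lam : R | 0 < lam < 1]
  (fun lam m n => mu (window_dev p q x lam m n) t) 1
  (fun _ _ _ => fuzzy_le1 (IF_normed_mu _ _ hIF) _ _).
have nu0 t (lam : R) m n : 0 <= nu (window_dev p q x lam m n) t.
  by have /andP[] := IF_nu01 hIF (window_dev p q x lam m n) t.
have infP t := inf_dlimsup_eq0P [set lam : R | 0 < lam < 1] _ (nu0 t).
split=> [/IF_cvg2P[/muP xmu /nuP xnu] t t0|H].
  split; first exact/supP/xmu.
  apply/infP => eps e0; have [lam lam01 Hlam] := xnu t t0 eps e0.
  by exists lam => //; apply: eventually2_mono Hlam => m n; rewrite ltrD2l ltrN2.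
apply/IF_cvg2P; split.
  by apply/muP => t t0; apply/supP; case: (H t t0).
apply/nuP => t t0 eps e0; have [_ /infP /(_ eps e0)[lam lam01 Hlam]] := H t t0.
by exists lam => //; apply: eventually2_mono Hlam => m n; rewrite ltrD2l ltrN2.
Qed.
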